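(* For every integer $n\ge 1$, $$f_n \bmod 10=\begin{cases}5 & \text{if } n\notin\{a_k\},\\ 1 & \text{if } n\in\{a_k\} \text{ and } u_n \bmod 4=0,\\ 3 & \text{if } n\in\{a_k\} \text{ and } u_n \bmod 4=1,\\ 7 & \text{if } n\in\{a_k\} \text{ and } u_n \bmod 4=3,\\ 9 & \text{if } n\in\{a_k\} \text{ and } u_n \bmod 4=2.\end{cases}$$
   Context: $f_n=\sum_{i=0}^n\binom{n}{i}\binom{2n-2i}{n-i}$. $\{a_k\}_{k\ge 1}$ denotes the set of all positive integers $n$, listed in increasing order $a_1<a_2<\cdots$, for which $\binom{2n}{n}$ is not divisible by 5. $u_n$ denotes the number of digits equal to 1 in the base 5 representation of $n$. $x \bmod m$ denotes the remainder in $\{0,\dots,m-1\}$ of $x$ on division by $m$. *)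

(* Defs.v *)
From mathcomp Require Import all_boot.

Set Implicit Arguments.
Unset Strict Implicit.
Unset Printing Implicit Defensive.

Definition f (n : nat) : nat :=
  \sum_(0 <= i < n.+1) 'C(n, i) * 'C(2 * n - 2 * i, n - i).

(* The set {a_k}; only membership matters, not the indexing by k. *)
Definition a_set : {pred nat} := [pred n | (0 < n) && ~~ (5 %| 'C(2 * n, n))].

(* Coefficient of b ^ i in the base b representation of n. *)
Definition digit (b n i : nat) : nat := (n %/ b ^ i) %% b.

Lemma digit_eq0 (b n i : nat) : 1 < b -> n <= i -> digit b n i = 0.
Proof.
move=> b_gt1 le_ni; rewrite /digit divn_small ?mod0n //.
exact: leq_ltn_trans le_ni (ltn_expl i b_gt1).
Qed.

(* By digit_eq0, every nonzero digit of n is in a position below n, so bounding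
   the positions by n loses nothing. *)
Definition u (n : nat) : nat := #|[set i : 'I_n | digit 5 n i == 1]|.

(* Main.v *)
Require Import Defs.
From mathcomp Require Import all_boot.
From mathcomp Require Import all_algebra.

Import GRing.Theory.

(** Both f n and 'C(2n, n) are the coefficient of X^n in Q^n for a quadratic
    polynomial Q: take Q = (X + 1)^2 + X for f and Q = (X + 1)^2 for the central
    binomial coefficient (f_coef, central_binomial_coef).

    Over the field with p elements Q^p is Q(X^p), so Q^(np+r) is the product of
    Q^n(X^p), which only involves powers of X^p, and of Q^r, whose degree is at
    most 2r. When r < p, the only index j congruent to r modulo p with
    0 <= j <= 2r is r itself, so the coefficient of X^(np+r) in Q^(np+r) is the
    product of the coefficients for n and for r (central_coef_Lucas).
    Hence both sequences are multiplicative modulo p along base p digits.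

    For p = 2, since f 0 = 1 and f 1 = 3 are odd, f is always odd. For p = 5, the
    digits 0, 1, 2, 3, 4 have f values 1, 3, 11, 45, 195, congruent to
    1, 3, 1, 0, 0, while their central binomial coefficients 1, 2, 6, 20, 70
    vanish modulo 5 exactly at 3 and 4. So f n is 0 modulo 5 when 5 divides
    'C(2n, n), and otherwise is 3 to the number of digits of n equal to 1
    (f_mod5). As 3 has order 4 modulo 5, the Chinese remainder theorem for
    10 = 2 * 5 gives the five cases. *)

Section CentralCoefficients.

Local Open Scope ring_scope.

(** The Frobenius map is a ring endomorphism of the polynomials that fixes the
    constants, as these lie in the prime field, and sends 'X to 'X^p; so does
    substitution of 'X^p. *)
Lemma Fp_poly_Frobenius (p : nat) (A : {poly 'F_p}) :
  prime p -> A ^+ p = A \Po 'X^p.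
Proof.
move=> p_pr; have pcharP : p \in [pchar {poly 'F_p}].
  by rewrite pchar_poly pchar_Fp.
elim/poly_ind: A => [|A c IHA].
  by rewrite comp_poly0 expr0n eqn0Ngt prime_gt0.
rewrite comp_poly_MXaddC -IHA -!(pFrobenius_autE pcharP).
rewrite pFrobenius_autD_comm; last exact: mulrC.
rewrite pFrobenius_autM_comm; last exact: mulrC.
congr (_ * _ + _).
by rewrite -[c]natr_Zp rmorph_nat pFrobenius_aut_nat.
Qed.

Lemma size_quadratic_exp (R : nzRingType) (Q : {poly R}) (n : nat) :
  (size Q <= 3)%N -> (size (Q ^+ n) <= (2 * n).+1)%N.
Proof.
move=> szQ; apply: leq_trans (size_poly_exp_leq Q n) _.
by rewrite ltnS leq_mul //; case: (size Q) szQ.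
Qed.

(** Of the product of Q^n(X^p) and Q^r, only one pair of terms contributes to
    X^(np+r): exponents in the first factor are multiples of p, and
    r is the only exponent of Q^r, among 0, ..., 2 * r, in its class modulo p. *)
Lemma central_coef_Lucas (p n r : nat) (Q : {poly 'F_p}) :
    prime p -> (size Q <= 3)%N -> (r < p)%N ->
  (Q ^+ (n * p + r))`_(n * p + r) = (Q ^+ n)`_n * (Q ^+ r)`_r.
Proof.
move=> p_pr szQ r_lt_p; have p_gt0 := prime_gt0 p_pr.
rewrite exprD exprM (Fp_poly_Frobenius _ _ p_pr) coefM.
have np_lt : (n * p < (n * p + r).+1)%N by rewrite ltnS leq_addr.
rewrite (bigD1 (Ordinal np_lt)) //= big1 ?addr0 => [|[j j_lt]].
  by rewrite coef_comp_poly_Xn // dvdn_mull // mulnK // addKn.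
rewrite -val_eqE /= => j_neq; rewrite coef_comp_poly_Xn //.
case: dvdnP => [[k def_j]|_]; last by rewrite mul0r.
(* A term with j = k * p and k < n pairs with a coefficient of Q ^+ r of index
   (n - k) * p + r > 2 * r, beyond its degree. *)
have k_lt_n : (k < n)%N.
  rewrite ltn_neqAle; apply/andP; split.
    by apply: contraNneq j_neq => <-; rewrite def_j.
  rewrite -ltnS -(ltn_pmul2r p_gt0) -def_j.
  by apply: leq_trans j_lt _; rewrite mulSn addnC -addSn leq_add2r.
rewrite [X in _ * X]nth_default ?mulr0 //.
apply: leq_trans (size_quadratic_exp _ _ r szQ) _.
rewrite def_j addnC -addnBA ?leq_mul2r ?(ltnW k_lt_n) ?orbT //.
rewrite -mulnBl mul2n -addnn -addnS leq_add2l.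
by apply: leq_trans r_lt_p _; rewrite leq_pmull ?subn_gt0.
Qed.

Lemma coef_X1_exp (R : comNzRingType) (n k : nat) :
  (('X + 1 : {poly R}) ^+ n)`_k = 'C(n, k)%:R.
Proof.
rewrite addrC exprDn.
under eq_bigr do rewrite expr1n mul1r -scaler_nat.
rewrite -(poly_def n.+1 (fun i => 'C(n, i)%:R)) coef_poly ltnS.
by case: leqP => // /bin_small ->.
Qed.

Lemma central_binomial_coef (R : comNzRingType) (n : nat) :
  'C(2 * n, n)%:R = ((('X + 1) ^+ 2 : {poly R}) ^+ n)`_n.
Proof. by rewrite -exprM coef_X1_exp. Qed.

(** In the binomial expansion of ((X + 1)^2 + X)^n, the term with X^i contributes
    the coefficient of X^(n-i) in (X + 1)^(2(n-i)). *)
Lemma f_coef (R : comNzRingType) (n : nat) :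
  (f n)%:R = ((('X + 1) ^+ 2 + 'X : {poly R}) ^+ n)`_n.
Proof.
rewrite /f big_mkord exprDn coef_sum natr_sum; apply: eq_bigr => i _.
have le_in : (i <= n)%N by rewrite -ltnS.
rewrite coefMn coefMXn ltnNge le_in /= -exprM coef_X1_exp.
by rewrite mulnBr natrM mulr_natl.
Qed.

Lemma size_X1_sqr (R : comNzRingType) :
  (size (('X + 1) ^+ 2 : {poly R})%R <= 3)%N.
Proof.
apply/leq_sizeP => j; rewrite coef_X1_exp => j_gt2.
by rewrite bin_small.
Qed.

Lemma size_X1_sqrDX (R : comNzRingType) :
  (size (('X + 1) ^+ 2 + 'X : {poly R})%R <= 3)%N.
Proof.
by rewrite (leq_trans (size_polyD _ _)) // geq_max size_X1_sqr size_polyX.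
Qed.

Lemma eq_Fp_nat (p a b : nat) :
  prime p -> (a%:R == b%:R :> 'F_p) = (a == b %[mod p]).
Proof. by move=> p_pr; rewrite -val_eqE /= !val_Fp_nat. Qed.

End CentralCoefficients.

Lemma f_Lucas (p n r : nat) :
  prime p -> r < p -> f (n * p + r) = f n * f r %[mod p].
Proof.
move=> p_pr r_lt_p; apply/eqP; rewrite -eq_Fp_nat // natrM !f_coef.
by rewrite central_coef_Lucas ?size_X1_sqrDX.
Qed.

Lemma central_binomial_Lucas (p n r : nat) :
    prime p -> r < p ->
  'C(2 * (n * p + r), n * p + r) = 'C(2 * n, n) * 'C(2 * r, r) %[mod p].
Proof.
move=> p_pr r_lt_p; apply/eqP; rewrite -eq_Fp_nat // natrM.
by rewrite !central_binomial_coef central_coef_Lucas ?size_X1_sqr.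
Qed.

(** The bound n on the digit positions may be raised, which lets the digits of n
    and of 5 * n + r be counted over compatible ranges. *)
Lemma uE (m n : nat) : n <= m -> u n = \sum_(i < m) (digit 5 n i == 1).
Proof.
move=> le_nm; rewrite /u cardsE -sum1_card big_mkcond.
rewrite -[RHS](big_mkord xpredT (fun i => (digit 5 n i == 1) : nat)).
rewrite (big_cat_nat (leq0n n) le_nm) //= [X in _ + X]big_nat_cond [X in _ + X]big1.
  by rewrite addn0 big_mkord; apply: eq_bigr => i _; rewrite unfold_in.
by move=> i /andP[/andP[le_ni _] _]; rewrite digit_eq0.
Qed.

Lemma u_digit (n r : nat) : r < 5 -> u (n * 5 + r) = (r == 1) + u n.
Proof.
move=> r_lt5; have le_n : n <= n * 5 + r.
  by apply: leq_trans (leq_addr _ _); rewrite leq_pmulr.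
rewrite (uE _ _ (leqnSn _)) (uE _ _ le_n) big_ord_recl; congr (_ + _).
  by rewrite /digit expn0 divn1 modnMDl modn_small.
apply: eq_bigr => i _; rewrite /digit /= /bump add1n expnS divnMA.
by rewrite divnMDl // (divn_small r_lt5) addn0.
Qed.

Lemma digit_ind (b : nat) (P : nat -> Prop) :
    1 < b -> P 0 -> (forall n r, r < b -> P n -> P (n * b + r)) ->
  forall n, P n.
Proof.
move=> b_gt1 P0 Pstep n; elim/ltn_ind: n => -[|n] IHn //.
rewrite (divn_eq n.+1 b); apply: Pstep; first by rewrite ltn_mod ltnW.
by apply: IHn; rewrite ltn_Pdiv.
Qed.

Lemma f_odd (n : nat) : f n %% 2 = 1.
Proof.
elim/(@digit_ind 2): n => [//||n r r_lt2 IHn]; first by rewrite /f unlock.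
rewrite f_Lucas // -modnMml IHn mul1n.
by case: r r_lt2 => [|[|]] //; rewrite /f unlock.
Qed.

Lemma f_mod5 (n : nat) :
  f n = (if 5 %| 'C(2 * n, n) then 0 else 3 ^ u n) %[mod 5].
Proof.
elim/(@digit_ind 5): n => [//||n r r_lt5 IHn].
  by rewrite /f unlock (uE _ _ (leqnn 0)) big_ord0.
rewrite f_Lucas // u_digit // expnD mulnC.
rewrite [5 %| _]/dvdn central_binomial_Lucas // -/(dvdn 5 _) Euclid_dvdM //.
have f_r : f r = (if 5 %| 'C(2 * r, r) then 0 else 3 ^ (r == 1)) %[mod 5].
  by case: r r_lt5 => [|[|[|[|[|r]]]]] //; rewrite /f unlock.
rewrite -modnMmr IHn modnMmr -modnMml f_r modnMml.
by case: (5 %| 'C(2 * n, n)); case: (5 %| 'C(2 * r, r)); rewrite ?muln0.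
Qed.

Lemma exp3_mod5 (m : nat) : 3 ^ m = 3 ^ (m %% 4) %[mod 5].
Proof.
rewrite {1}(divn_eq m 4) mulnC expnD expnM -modnMml.
by rewrite -(modnXm (m %/ 4) 5 (3 ^ 4)) (exp1n (m %/ 4)) mul1n.
Qed.

Theorem theorem3 (n : nat) (n_ge1 : 1 <= n) :
  [/\ n \notin a_set -> f n %% 10 = 5,
      n \in a_set -> u n %% 4 = 0 -> f n %% 10 = 1,
      n \in a_set -> u n %% 4 = 1 -> f n %% 10 = 3,
      n \in a_set -> u n %% 4 = 3 -> f n %% 10 = 7
    & n \in a_set -> u n %% 4 = 2 -> f n %% 10 = 9].
Proof.
have mod10 x : x < 10 -> x %% 2 = 1 -> f n = x %[mod 5] -> f n %% 10 = x.
  move=> x_lt10 odd_x eq5; rewrite -(modn_small x_lt10); apply/eqP.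
  by rewrite (@chinese_remainder 2 5) // f_odd odd_x eq5 !eqxx.
have := f_mod5 n; rewrite inE /= n_ge1 /=.
case: (5 %| _) => /= f5; split=> // _; first by apply: mod10.
all: by move=> un; apply: mod10; rewrite // f5 exp3_mod5 un.
Qed.
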